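(* Let $d_1, d_2 \geq 1$. Let $\mathcal{F}$ be a finite family of sets, each with at most $d_1$ elements, and let $\mathcal{H}$ be a family of minimal covers of $\mathcal{F}$, each with at most $d_2$ elements. Then $|\bigcup \mathcal{H}| \leq b(d_1,d_2)$. Moreover this inequality is best possible: there exist such $\mathcal{F}$ and $\mathcal{H}$ with $|\bigcup \mathcal{H}| = b(d_1,d_2)$.
   Context: A set $C$ is a cover of a family $\mathcal{F}$ if $C \cap E \neq \emptyset$ for every $E \in \mathcal{F}$; it is a minimal cover if no proper subset of $C$ is a cover of $\mathcal{F}$. For a finite graph $G$, a family of subsets of $V(G)$ is an edge cover of $G$ iff every edge of $G$ is included in some member; it is a minimal edge cover iff no proper subfamily is an edge cover. $b(d_1,d_2)$ is the maximum cardinality of a minimal edge cover $\mathcal{C}$ of a complete bipartite graph with parts $V_1$ and $V_2$ such that every vertex of $V_1$ lies in at most $d_1$ members of $\mathcal{C}$ and every vertex of $V_2$ lies in at most $d_2$ members of $\mathcal{C}$. *)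

(* Defs.v *)
From HB Require Import structures.
From mathcomp Require Import all_boot.
From mathcomp Require Import boolp classical_sets functions cardinality.

Set Implicit Arguments.
Unset Strict Implicit.
Unset Printing Implicit Defensive.

Local Open Scope classical_set_scope.
Local Open Scope card_scope.

Definition is_cover (T : Type) (F : set (set T)) (C : set T) : Prop :=
  forall E, F E -> C `&` E !=set0.

Definition minimal_cover (T : Type) (F : set (set T)) (C : set T) : Prop :=
  is_cover F C /\ forall D, D `<` C -> ~ is_cover F D.

(* A graph on a finite vertex set [V] is given by its adjacency relation. *)
Definition edge_cover (V : finType) (e : rel V) : pred {set {set V}} :=
  fun C => [forall x, forall y,
    e x y ==> [exists A in C, [set x; y]%SET \subset A]].

Definition minimal_edge_cover (V : finType) (e : rel V) (C : {set {set V}}) :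
    Prop :=
  edge_cover e C /\ forall D : {set {set V}}, D \proper C -> ~~ edge_cover e D.

Definition complete_bipartite (V1 V2 : finType) : rel (V1 + V2)%type :=
  fun x y => match x, y with
             | inl _, inr _ | inr _, inl _ => true
             | _, _ => false
             end.

Definition bipartite_cover_size (d1 d2 : nat) : set nat :=
  [set n | exists (V1 V2 : finType) (C : {set {set (V1 + V2)%type}}),
    [/\ minimal_edge_cover (@complete_bipartite V1 V2) C,
        forall v : V1, #|[set A in C | inl v \in A]%SET| <= d1,
        forall v : V2, #|[set A in C | inr v \in A]%SET| <= d2
      & #|C| = n]].

(* The maximum of [bipartite_cover_size d1 d2]. If there were no maximum, the
   value would be 0, whereas 1 is an attained size as soon as d1, d2 >= 1 (one
   edge, covered by its pair of ends). *)
Definition b (d1 d2 : nat) : nat :=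
  xget 0 [set n | bipartite_cover_size d1 d2 n /\
                  forall m, bipartite_cover_size d1 d2 m -> m <= n].

(* [H] is automatically finite; it is not assumed to be. *)
Definition bounded_cover_system (d1 d2 : nat) (T : Type)
    (F H : set (set T)) : Prop :=
  [/\ finite_set F,
      forall E, F E -> E #<= `I_d1,
      forall C, H C -> minimal_cover F C
    & forall C, H C -> C #<= `I_d2].

(* Main.v *)
(** A minimal edge cover of a complete bipartite graph is the same thing as a
    family S1 x (x in V1) and a family S2 y (y in V2) of subsets of a set X such
    that every S1 x meets every S2 y and every point of X is the only point of
    some S1 x :&: S2 y: X is the edge cover, and S1 x, S2 y consist of the
    members containing the given vertex.  With V1 = F and V2 = H this is also
    what minimality of the covers in H says about X = \bigcup H.  Conversely,
    starting from S1 and S2, any minimal subcover of S2 y retains the points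
    isolated by y, so such subcovers form a family H with union X.  The maximum
    b d1 d2 exists because the covers of size at most d2 of a family of sets of
    size at most d1 all have subcovers inside one set of bounded size. *)
Require Import Defs.
From HB Require Import structures.
From mathcomp Require Import all_boot.
From mathcomp Require Import boolp classical_sets functions cardinality.

Set Implicit Arguments.
Unset Strict Implicit.
Unset Printing Implicit Defensive.

Local Open Scope classical_set_scope.
Local Open Scope card_scope.

(** * Minimal edge covers as pairs of set families *)

Definition cross_system (d1 d2 : nat) (X V1 V2 : finType)
    (S1 : V1 -> {set X}) (S2 : V2 -> {set X}) : Prop :=
  [/\ forall x, #|S1 x| <= d1, forall y, #|S2 y| <= d2,
      forall x y, S1 x :&: S2 y != finset.set0
    & forall a, exists x y, S1 x :&: S2 y = [set a]]%SET.

Lemma bipartite_edge_coverP (V1 V2 : finType)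
    (C : {set {set (V1 + V2)%type}}) :
  reflect (forall x y, exists A, [/\ A \in C, inl x \in A & inr y \in A])
    (edge_cover (@complete_bipartite V1 V2) C).
Proof.
apply: (iffP forallP) => [cov x y | cov u].
  have /forallP/(_ (inr y))/existsP[A /andP[AC]] := cov (inl x).
  by rewrite finset.subUset !finset.sub1set => /andP[xA yA]; exists A.
apply/forallP => v; apply/implyP.
case: u v => [x|y] [y'|x'] //= _.
  have [A [AC xA yA]] := cov x x'.
  by apply/existsP; exists A; rewrite AC finset.subUset !finset.sub1set xA yA.
have [A [AC xA yA]] := cov y' y.
by apply/existsP; exists A; rewrite AC finset.subUset !finset.sub1set xA yA.
Qed.

(** An edge left uncovered when [A] is removed from [C] lies in [A] alone; conversely, an edge lying
    in [A] alone is lost by every subfamily omitting [A]. *)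
Lemma minimal_bipartite_edge_coverP (V1 V2 : finType)
    (C : {set {set (V1 + V2)%type}}) :
  minimal_edge_cover (@complete_bipartite V1 V2) C <->
  (forall x y, exists A, [/\ A \in C, inl x \in A & inr y \in A]) /\
  (forall A, A \in C -> exists x y, [/\ inl x \in A, inr y \in A &
     forall B, B \in C -> inl x \in B -> inr y \in B -> B = A]).
Proof.
split=> [[/bipartite_edge_coverP cov minC] | [cov priv]].
  split=> // A AC; apply: contrapT => noxy.
  have /negP[] := minC _ (properD1 AC); apply/bipartite_edge_coverP => x y.
  apply: contrapT => noB; apply: noxy; exists x, y.
  have onlyA B : B \in C -> inl x \in B -> inr y \in B -> B = A.
    move=> BC xB yB; apply/eqP; apply: contrapT => /negP BA.
    by apply: noB; exists B; rewrite !inE BA.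
  have [B [BC xB yB]] := cov x y.
  by move: (xB) (yB); rewrite (onlyA B BC xB yB); split.
split; first exact/bipartite_edge_coverP.
move=> D /properP[/fintype.subsetP DC [A AC AD]].
apply/negP => /bipartite_edge_coverP covD.
have [x [y [_ _ uniqA]]] := priv A AC.
have [B [BD xB yB]] := covD x y.
by rewrite -(uniqA B) ?BD // DC in AD.
Qed.

Lemma bipartite_cover_sizeP (d1 d2 n : nat) :
  bipartite_cover_size d1 d2 n <->
  exists (V1 V2 : finType) (S1 : V1 -> {set 'I_n}) (S2 : V2 -> {set 'I_n}),
    cross_system d1 d2 S1 S2.
Proof.
split.
  case=> [V1 [V2 [C [/minimal_bipartite_edge_coverP[cov priv] deg1 deg2 <-]]]].
  have card_star (v : V1 + V2) :
      #|[set i : 'I_#|C| | v \in enum_val i]%SET|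
        <= #|[set A in C | v \in A]%SET|.
    rewrite -(card_imset _ enum_val_inj); apply/subset_leq_card.
    apply/fintype.subsetP => _ /imsetP[i + ->].
    by rewrite !inE enum_valP.
  exists V1, V2, (fun x => [set i : 'I_#|C| | inl x \in enum_val i]%SET),
    (fun y => [set i : 'I_#|C| | inr y \in enum_val i]%SET).
  split=> [x|y|x y|a].
  - exact: leq_trans (card_star _) (deg1 x).
  - exact: leq_trans (card_star _) (deg2 y).
  - have [A [AC xA yA]] := cov x y.
    by apply/set0Pn; exists (enum_rank_in AC A); rewrite !inE enum_rankK_in ?xA.
  - have [x [y [xA yA uniqA]]] := priv _ (enum_valP a).
    exists x, y; apply/setP => i; rewrite !inE.
    apply/andP/eqP => [[xi yi]|->//].
    exact/enum_val_inj/(uniqA _ (enum_valP i)).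
case=> [V1 [V2 [S1 [S2 [le1 le2 cross single]]]]].
pose A (i : 'I_n) : {set (V1 + V2)%type} :=
  [set v | match v with inl x => i \in S1 x | inr y => i \in S2 y end]%SET.
have memA1 i x : (inl x \in A i) = (i \in S1 x) by rewrite inE.
have memA2 i y : (inr y \in A i) = (i \in S2 y) by rewrite inE.
have priv i : exists x y, [/\ inl x \in A i, inr y \in A i &
    forall j, inl x \in A j -> inr y \in A j -> j = i].
  have [x [y /setP xy]] := single i; exists x, y; rewrite memA1 memA2.
  have := xy i; rewrite !inE eqxx => /andP[xi yi]; split=> // j.
  by rewrite memA1 memA2 => xj yj; apply/eqP; have := xy j; rewrite !inE xj yj.
(* The edge cover is a set, so repeated values of [A] would be counted once. If [A i = A j], the
   private edge of [j] lies in [A i] as well, which forces [i = j]. *)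
have injA : injective A.
  move=> i j eqA; have [x [y [+ + uniqj]]] := priv j.
  by rewrite -eqA; apply: uniqj.
exists V1, V2, (A @: [set: 'I_n]%SET); split.
- apply/minimal_bipartite_edge_coverP; split=> [x y | _ /imsetP[i _ ->]].
    have /set0Pn[i] := cross x y; rewrite inE => /andP[xi yi].
    by exists (A i); rewrite memA1 memA2 imset_f ?inE.
  have [x [y [xi yi uniqi]]] := priv i; exists x, y; split=> //.
  by move=> _ /imsetP[j _ ->] xj yj; rewrite (uniqi j).
- move=> x; rewrite (leq_trans _ (le1 x)) // -(card_imset _ injA).
  apply/subset_leq_card/fintype.subsetP => _ /setIdP[/imsetP[i _ ->]].
  by rewrite memA1 => xi; apply: imset_f.
- move=> y; rewrite (leq_trans _ (le2 y)) // -(card_imset _ injA).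
  apply/subset_leq_card/fintype.subsetP => _ /setIdP[/imsetP[i _ ->]].
  by rewrite memA2 => yi; apply: imset_f.
- by rewrite card_imset // cardsT card_ord.
Qed.

(** * Existence of the maximum [b d1 d2] *)

(** This is [d + d^2 + ... + d^k], the number of non-root nodes of a [d]-branching search tree of
    depth [k]. *)
Fixpoint branching_bound (d k : nat) : nat :=
  if k is k'.+1 then d + d * branching_bound d k' else 0.

(* Branching: a cover meets a fixed member [E] in one of at most [d] points
   [a]; recurse on the members avoiding [a]. *)
Lemma subcovers_bounded (X : finType) (d k : nat) (Fam : {set {set X}}) :
  (forall E, E \in Fam -> #|E| <= d) ->
  exists2 U : {set X}, #|U| <= branching_bound d k &
    forall D : {set X}, #|D| <= k ->
      (forall E, E \in Fam -> E :&: D != finset.set0)%SET ->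
      forall E, E \in Fam -> (E :&: (D :&: U) != finset.set0)%SET.
Proof.
elim: k Fam => [|k IHk] Fam leF.
  (* For [k = 0] the set [D] is empty, so it can only cover an empty [Fam]. *)
  exists finset.set0 => [|D]; first by rewrite cards0.
  rewrite leqn0 cards_eq0 => /eqP-> cov E /cov.
  by rewrite finset.setI0 eqxx.
have [->|[E0 E0F]] := set_0Vmem Fam.
  by exists finset.set0 => [|D _ _ E]; rewrite ?cards0 ?inE.
pose Fa a := [set E in Fam | a \notin E]%SET.
have leFa a E : E \in Fa a -> #|E| <= d by case/setIdP => /leF.
pose U a := s2val (cid2 (IHk (Fa a) (leFa a))).
have cardU a : #|U a| <= branching_bound d k by rewrite /U; case: cid2.
have covU a (D : {set X}) : #|D| <= k ->
    (forall E, E \in Fa a -> E :&: D != finset.set0)%SET ->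
    forall E, E \in Fa a -> (E :&: (D :&: U a) != finset.set0)%SET.
  by rewrite /U; case: cid2 => V /= _; apply.
exists (E0 :|: \bigcup_(a in E0) U a)%SET.
  apply: leq_trans (leq_card_setU _ _) _; rewrite leq_add ?leF //.
  have -> : (\bigcup_(a in E0) U a = finset.cover (U @: E0))%SET.
    by rewrite cover_imset.
  apply: leq_trans (leq_card_cover _) _.
  apply: (@leq_trans (\sum_(B in U @: E0) branching_bound d k)).
    by apply: leq_sum => _ /imsetP[a _ ->].
  by rewrite sum_nat_const leq_mul // (leq_trans (leq_imset_card _ _)) ?leF.
move=> D leD cov E EF.
have /set0Pn[a /setIP[aE0 aD]] := cov E0 E0F.
(* If [a \in E], then [a] itself serves. Otherwise [E] is in [Fa a], which is already covered by the
   at most [k] points of [D :\ a]. *)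
have [aE|aNE] := boolP (a \in E).
  by apply/set0Pn; exists a; rewrite !inE aE aD aE0.
have /set0Pn[c] : (E :&: ((D :\ a) :&: U a) != finset.set0)%SET.
  apply: covU; rewrite ?inE ?EF //.
    by rewrite (cardsD1 a) aD in leD.
  move=> E' /setIdP[/cov/set0Pn[c /setIP[cE' cD]] aNE'].
  apply/set0Pn; exists c; rewrite !inE cE' cD !andbT.
  by apply: contraNneq aNE' => <-.
rewrite !inE => /and3P[cE /andP[_ cD] cU]; apply/set0Pn; exists c.
rewrite !inE cE cD /=; apply/orP; right.
by apply/bigcupP; exists a.
Qed.

(** Each [S2 y] covers all the sets [S1 x], hence so does its trace on [U]. Where [S1 x] and [S2 y]
    share only [a], this puts [a] in [U]; so [U] is all of [X]. *)
Lemma cross_system_bounded (d1 d2 : nat) (X V1 V2 : finType)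
    (S1 : V1 -> {set X}) (S2 : V2 -> {set X}) :
  cross_system d1 d2 S1 S2 -> #|X| <= branching_bound d1 d2.
Proof.
case=> le1 le2 cross single.
have leS1 E : E \in [set S1 x | x : V1]%SET -> #|E| <= d1.
  by case/imsetP => x _ ->.
have [U cardU covU] := subcovers_bounded d2 leS1.
rewrite (leq_trans _ cardU) //; apply/subset_leq_card/fintype.subsetP => a _.
have [x [y xy]] := single a.
have /set0Pn[c] : (S1 x :&: (S2 y :&: U) != finset.set0)%SET.
  apply: covU => //; last exact: imset_f.
  by move=> _ /imsetP[x' _ ->].
by rewrite finset.setIA xy => /setIP[/set1P->].
Qed.

Lemma b_is_max (d1 d2 : nat) :
  bipartite_cover_size d1 d2 (b d1 d2) /\
  forall m, bipartite_cover_size d1 d2 m -> m <= b d1 d2.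
Proof.
pose P n := `[< bipartite_cover_size d1 d2 n >].
have exP : exists n, P n.
  (* Empty parts with the empty cover attain size 0. *)
  exists 0; apply/asboolP/bipartite_cover_sizeP.
  exists void, void, (fun=> finset.set0), (fun=> finset.set0).
  by split=> [[]|[]|[]|[]].
have leP n : P n -> n <= branching_bound d1 d2.
  move=> /asboolP/bipartite_cover_sizeP[V1 [V2 [S1 [S2]]]].
  move=> /cross_system_bounded.
  by rewrite card_ord.
have [n /asboolP Pn maxn] := ex_maxnP exP leP.
apply: (@xgetI _ 0 [set k | bipartite_cover_size d1 d2 k /\
  forall m, bipartite_cover_size d1 d2 m -> m <= k] n).
by split=> // m Pm; apply/maxn/asboolP.
Qed.

(** * Unions of minimal covers: upper bound and sharpness *)

Lemma card_finset (T : finType) (A : {set T}) : [set` A] #= `I_#|A|.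
Proof.
have -> : [set` A] = range (@enum_val T (mem A)).
  apply/seteqP; split=> [x /= xA | _ [i _ <-] /=]; last exact: enum_valP.
  by exists (enum_rank_in xA x) => //; rewrite enum_rankK_in.
apply: card_eq_trans (inj_card_eq _) _.
  by move=> i j _ _; exact: enum_val_inj.
by rewrite card_eq_sym card_II.
Qed.

(** By minimality [C] without [t] misses some [E]; since [C] itself meets [E], it does so in [t]
    alone. *)
Lemma minimal_cover_private (T : Type) (F : set (set T)) (C : set T) (t : T) :
  minimal_cover F C -> C t ->
  exists2 E, F E & forall s, (E `&` C) s <-> s = t.
Proof.
move=> [cov minC] Ct; apply: contrapT => noE.
have lt : C `\ t `<` C.
  by split=> [s [] //|/(_ t Ct)[_]]; apply.
apply: (minC _ lt) => E FE; apply: contrapT => no.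
have Et s : (C `&` E) s -> s = t.
  move=> [Cs Es]; apply: contrapT => st; apply: no; exists s.
  by split.
apply: noE; exists E => // s; split=> [[Es Cs]|->]; first exact: Et.
have [s' CEs'] := cov E FE.
by have <- := Et _ CEs'; case: CEs'.
Qed.

Lemma finite_enum (T : Type) (U : set T) :
  finite_set U ->
  exists n (h : 'I_n -> T), injective h /\ forall t, U t <-> exists i, h i = t.
Proof.
case=> n; rewrite (card_eqr card_II) card_eq_sym => /card_bijP[f [g fK gK]].
exists n, (fun i => val (f (to_setT i))); split=> [i j /val_inj/(can_inj fK)|t].
  by move/(congr1 val).
split=> [Ut|[i <-]]; last exact: set_valP.
exists (val (g (SigSub (mem_set Ut)))).
by rewrite (_ : to_setT _ = g (SigSub (mem_set Ut))) ?gK //; apply: val_inj.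
Qed.

Lemma card_bigcup_minimal_cover (d1 d2 : nat) (T : Type) (F H : set (set T)) :
  bounded_cover_system d1 d2 F H ->
  \bigcup_(C in H) C #<= `I_(b d1 d2).
Proof.
case=> finF leF minH leH.
(* A point of a minimal cover lies in its private member of [F], so the union of [H] is contained in
   the finite union of [F]. *)
have finU : finite_set (\bigcup_(C in H) C).
  have : finite_set (\bigcup_(E in F) E).
    apply: bigcup_finite => // E FE.
    exact: card_le_finite (leF E FE) (finite_II d1).
  apply: sub_finite_set => t [C HC Ct].
  have [E FE /(_ t) [_ /(_ erefl)[Et _]]] :=
    minimal_cover_private (minH C HC) Ct.
  by exists E.
have [n [h [injh hP]]] := finite_enum finU.
have Uh i : (\bigcup_(C in H) C) (h i) by apply/hP; exists i.
pose pre (E : set T) := [set i | `[< E (h i) >]]%SET.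
have card_pre E d : E #<= `I_d -> #|pre E| <= d.
  move=> leE; rewrite -card_le_II -(card_le_eql (card_finset _)).
  apply: card_le_trans leE.
  rewrite -(card_le_eql (inj_card_eq (in2W injh))).
  by apply: subset_card_le => _ [i /= + <-]; rewrite inE => /asboolP.
have UI : \bigcup_(C in H) C #= `I_n.
  have -> : \bigcup_(C in H) C = range h.
    by apply/seteqP; split=> [t /hP[i <-]|_ [i _ <-]]; [exists i|exact: Uh].
  by rewrite (card_eql (inj_card_eq (in2W injh))) card_eq_sym card_II.
rewrite (card_le_eql UI) card_le_II; apply: (b_is_max d1 d2).2.
apply/bipartite_cover_sizeP.
(* Traces on the union are subsets of ['I_n], so they form a finite type and can serve as the
   vertices of the graph. *)
pose fam (F : set (set T)) :=
  {A : {set 'I_n} | `[< exists2 E, F E & A = pre E >]}.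
exists (fam F), (fam H), val, val; split.
- by case=> A /= /asboolP[E FE ->]; apply/card_pre/leF.
- by case=> A /= /asboolP[E FE ->]; apply/card_pre/leH.
- case=> A1 /= /asboolP[E FE ->] [A2 /= /asboolP[C HC ->]].
  have [t [Ct Et]] := (minH C HC).1 E FE.
  (* Restricting to the union loses no intersection, because the common point lies in [C]. *)
  have /hP[i hi] : (\bigcup_(C in H) C) t by exists C.
  by apply/set0Pn; exists i; rewrite !inE hi; apply/andP; split; apply/asboolP.
- move=> i; have [C HC Ci] := Uh i.
  have [E FE EC] := minimal_cover_private (minH C HC) Ci.
  have FA : `[< exists2 E', F E' & pre E = pre E' >] by apply/asboolP; exists E.
  have HA : `[< exists2 E', H E' & pre C = pre E' >] by apply/asboolP; exists C.
  exists (exist _ (pre E) FA : fam F), (exist _ (pre C) HA : fam H);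
  apply/setP => j; rewrite !inE /=.
  apply/andP/eqP => [[/asboolP Ej /asboolP Cj]|->].
    by apply/injh/EC.
  by have /EC[Ei _] : h i = h i by []; split; apply/asboolP.
Qed.

Lemma extremal_system (d1 d2 : nat) :
  exists (T : Type) (F H : set (set T)),
    bounded_cover_system d1 d2 F H /\ \bigcup_(C in H) C #= `I_(b d1 d2).
Proof.
have /bipartite_cover_sizeP[V1 [V2 [S1 [S2 [le1 le2 cross single]]]]] :=
  (b_is_max d1 d2).1.
pose F := range (fun x => [set` S1 x]).
(* With all admissible covers taken, it remains to find one through each point. *)
pose H := [set C | minimal_cover F C /\ C #<= `I_d2].
exists 'I_(b d1 d2), F, H; split.
  split=> [|_ [x _ <-]|C [] //|C [] //]; first exact/finite_image/finite_finset.
  by rewrite (card_le_eql (card_finset _)) card_le_II.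
suff -> : \bigcup_(C in H) C = setT by rewrite card_eq_sym card_II.
apply/seteqP; split=> // a _.
have [x [y xy]] := single a.
pose covb (A : {set 'I_(b d1 d2)}) := [forall x, S1 x :&: A != finset.set0]%SET.
have /minset_exists[A /minsetP[/forallP covA minA] AS2] : covb (S2 y).
  by apply/forallP => x'.
(* The subcover [A] of [S2 y] still meets [S1 x], which is possible only at [a]. *)
have aA : a \in A.
  have /set0Pn[c /setIP[cx cA]] := covA x.
  suff <- : c = a by [].
  by apply/set1P; rewrite -xy inE cx (fintype.subsetP AS2).
exists [set` A] => //; split; last first.
  by rewrite (card_le_eql (card_finset _)) card_le_II
    (leq_trans (subset_leq_card AS2)).
split=> [_ [x' _ <-]|D [DA nAD] covD].
  by have /set0Pn[c /setIP[cx cA]] := covA x'; exists c.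
(* The competitor [D] is turned into a finite set, so that the choice of [A] as a minimal set
   applies to it. *)
pose B := [set i | `[< D i >]]%SET.
have BA : B = A.
  apply: minA.
    apply/forallP => x'; have [|c [Dc cx]] := covD [set` S1 x'].
      by exists x'.
    by apply/set0Pn; exists c; rewrite !inE cx; apply/asboolP.
  by apply/fintype.subsetP => i; rewrite inE => /asboolP/DA.
by apply: nAD => i /=; rewrite -BA inE => /asboolP.
Qed.

Theorem theorem5p2 (d1 d2 : nat) (hd1 : 1 <= d1) (hd2 : 1 <= d2) :
  (forall (T : Type) (F H : set (set T)),
     bounded_cover_system d1 d2 F H ->
     \bigcup_(C in H) C #<= `I_(b d1 d2)) /\
  (exists (T : Type) (F H : set (set T)),
     bounded_cover_system d1 d2 F H /\
     \bigcup_(C in H) C #= `I_(b d1 d2)).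
Proof.
split; last exact: extremal_system.
by move=> T F H; apply: card_bigcup_minimal_cover.
Qed.
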